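(* Let $N,K\geq 1$ be natural numbers. (1) For each natural number $n$ with $0\leq n\leq N$, $$\sum_{0\leq i<n} C_{N}(K,i) \;=\; \frac{n}{K}\cdot \left(\!\!\binom{K}{n}\!\!\right).$$ (2) For each natural number $i$ with $i<N$, $$C_{N}(K,i) \;=\; \left(\!\!\binom{K}{i}\!\!\right).$$
   Context: For $N\geq 1$ write $\boldsymbol{N}=\{0,1,\ldots,N-1\}\subseteq\mathbb{N}$. For $K\in\mathbb{N}$ and $0\leq i\leq (N-1)\cdot K$, the $N$-nomial coefficient is the natural number $$C_{N}(K,i) := \big|\{(n_1,\ldots,n_K)\in\boldsymbol{N}^{K} \mid n_1+\cdots+n_K = i\}\big|.$$ For $m\geq 1$ and $j\geq 0$, the multichoose coefficient is $$\left(\!\!\binom{m}{j}\!\!\right) := \frac{(m+j-1)!}{(m-1)!\cdot j!}.$$ *)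

(* Defs.v *)
From HB Require Import structures.
From mathcomp Require Import all_boot all_order all_algebra.

Set Implicit Arguments.
Unset Strict Implicit.
Unset Printing Implicit Defensive.

Import Order.TTheory GRing.Theory Num.Theory.

Definition nnomial (N K i : nat) : nat :=
  #|[set t : K.-tuple 'I_N | \sum_(k < K) (tnth t k : nat) == i]|.

Local Open Scope ring_scope.

(* The quotient is taken in rat, so no truncated division is involved; the
   predecessors are the intended ones only for m >= 1. *)
Definition multichoose (m j : nat) : rat :=
  ((m + j).-1)`!%:R / ((m.-1)`!%:R * j`!%:R).

(* Main.v *)
Require Import Defs.
From mathcomp Require Import all_boot all_order all_algebra.
Import GRing.Theory Num.Theory.
Local Open Scope ring_scope.

(** Write [K = k.+1]. Below [N], both the N-nomial and the multichoose coefficient equal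
    ['C(k + i, k)], which is (2). For (1), the hockey-stick identity sums these to
    ['C(k + n, k.+1)], and absorption turns this into [n / K] times ['C(k + n, k)]. *)

(* As each part of a sum equal to [i] is at most [i], the bound [N] on the parts
   is void for [i < N], and [nnomial] counts all weak compositions of [i]. *)
Lemma nnomial_bin (N k i : nat) : (i < N)%N -> nnomial N k.+1 i = 'C(k + i, k).
Proof.
move=> lt_iN; rewrite -card_ord_partitions /nnomial.
(* Stars and bars counts tuples over ['I_i.+1]; [w] rereads their entries in ['I_N]. *)
pose w := map_tuple (n := k.+1) (widen_ord lt_iN).
have w_inj : injective w.
  move=> s t /(congr1 val) /= /inj_map eq_st; apply/val_inj/eq_st.
  by move=> x y /(congr1 val) /= /val_inj.
rewrite -(card_imset _ w_inj); congr #|pred_of_set _|.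
apply/setP=> t; rewrite inE; apply/eqP/imsetP => [sum_t | [s s_part ->]].
  have t_le j : (tnth t j <= i)%N by rewrite -sum_t (bigD1 j) //= leq_addr.
  exists [tuple inord (tnth t j) : 'I_i.+1 | j < k.+1].
    rewrite inE big_tuple -[X in _ == X]sum_t; apply/eqP/eq_bigr => j _.
    by rewrite tnth_mktuple inordK // ltnS.
  apply: eq_from_tnth => j; apply: val_inj.
  by rewrite tnth_map tnth_mktuple /= inordK // ltnS.
move: s_part; rewrite inE big_tuple => /eqP sum_s.
by rewrite -[RHS]sum_s; apply: eq_bigr => j _; rewrite tnth_map.
Qed.

(** Pascal's rule makes each summand the difference of consecutive right-hand sides. *)
Lemma sum_bin_hockey_stick (k n : nat) :
  (\sum_(0 <= i < n) 'C(k + i, k))%N = 'C(k + n, k.+1).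
Proof.
elim: n => [|n IHn]; first by rewrite big_geq // addn0 bin_small.
by rewrite big_nat_recr //= IHn addnS binS.
Qed.

Lemma multichoose_bin (k i : nat) : multichoose k.+1 i = 'C(k + i, k)%:R.
Proof.
rewrite /multichoose -natrM addSn /= -(bin_fact (leq_addr i k)) addKn natrM.
by rewrite mulfK // pnatr_eq0 muln_eq0 negb_or -!lt0n !fact_gt0.
Qed.

Theorem theorem2 (N K : nat) (hN : (1 <= N)%N) (hK : (1 <= K)%N) :
  (forall n : nat, (n <= N)%N ->
     ((\sum_(0 <= i < n) nnomial N K i)%N)%:R
       = (n%:R / K%:R) * multichoose K n :> rat)
  /\
  (forall i : nat, (i < N)%N -> (nnomial N K i)%:R = multichoose K i :> rat).
Proof.
case: K hK => // k _; split=> [n le_nN | i lt_iN]; last first.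
  by rewrite nnomial_bin // multichoose_bin.
(* The sum stops at [n - 1], so even [n = N] keeps every index below [N]. *)
rewrite multichoose_bin (eq_big_nat _ _ (F2 := fun i => 'C(k + i, k))); last first.
  by move=> i /andP[_ lt_in]; rewrite nnomial_bin // (leq_trans lt_in).
rewrite sum_bin_hockey_stick mulrAC; apply/(canRL (mulfK _)).
  by rewrite pnatr_eq0.
(* Absorption: [k.+1 * 'C(k + n, k.+1) = n * 'C(k + n, k)]. *)
by rewrite -!natrM mulnC mul_bin_left addKn.
Qed.
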